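(* For any finite field $\mathbb{F}_q$ and any $3$-tensor $T$ over $\mathbb{F}_q$, $$\operatorname{SR}(T) \le \left(3 + \frac{2}{q-1}\right)\operatorname{AR}(T).$$
   Context: Let $\mathbb{F} = \mathbb{F}_q$ and let $x_i = (x_{i,1},\ldots,x_{i,n})$, $i=1,2,3$, be tuples of variables, with $n$ arbitrary. For $S \subseteq \{1,2,3\}$, $\mathcal{M}_S$ is the space of multilinear forms over $\mathbb{F}$ linear in each $x_i$ with $i \in S$ (the span of the monomials $\prod_{i \in S} x_{i,j_i}$). A $3$-tensor is an element $T \in \mathcal{M}_{\{1,2,3\}}$. The analytic rank is $\operatorname{AR}(T) = -\log_q \operatorname{bias}(T)$, where $\operatorname{bias}(T)$ is the probability, over uniformly random $(p_1,p_2) \in (\mathbb{F}^n)^2$, that the linear form $T(p_1,p_2,x_3)$ in $x_3$ is identically zero. The slice rank $\operatorname{SR}(T)$ is the minimum $r$ such that $T$ is a sum of $r$ tensors of the form $T_1T_2$ with $T_1 \in \mathcal{M}_S$, $T_2 \in \mathcal{M}_{S'}$, $S \sqcup S' = \{1,2,3\}$ and $|S| = 1$ (the partition may vary between summands). *)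

(* Defs.v *)
From HB Require Import structures.
From mathcomp Require Import all_boot all_order all_algebra.
(* The notations of multinomials clash with those of the analysis library. *)
From mathcomp Require Import -(notations) boolp reals exp.
From mathcomp Require Import mpoly.

Set Implicit Arguments.
Unset Strict Implicit.
Unset Printing Implicit Defensive.

Import GRing.Theory.
Local Open Scope ring_scope.

(* The ring F[x_1, x_2, x_3] with x_i = (x_{i,1}, .., x_{i,n}) is
   {mpoly F[3 * n]}; the index of a variable is a position in a 3 x n matrix,
   flattened by mxvec_index. Tuples and variables are numbered from 0. *)
Definition xvar (F : fieldType) (n : nat) (i : 'I_3) (j : 'I_n) :
  {mpoly F[3 * n]} := 'X_(mxvec_index i j).

(* A choice of one j_i for each i in S. *)
Definition index_choice (n : nat) (S : {set 'I_3}) : finType :=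
  {ffun {i in S} -> 'I_n}.

Definition ml_monomial (F : fieldType) (n : nat) (S : {set 'I_3})
  (j : index_choice n S) : {mpoly F[3 * n]} :=
  \prod_(i : {i in S}) xvar F (val i) (j i).

(* Membership in M_S. *)
Definition multilinear (F : fieldType) (n : nat) (S : {set 'I_3})
  (p : {mpoly F[3 * n]}) : Prop :=
  exists c : index_choice n S -> F, p = \sum_j c j *: ml_monomial F j.

Record tensor3 (F : fieldType) (n : nat) := Tensor3 {
  tensor_poly :> {mpoly F[3 * n]};
  tensor_multilinear : multilinear [set: 'I_3] tensor_poly }.

(* T(p1, p2, x_3), a polynomial in the n variables x_3. *)
Definition partial_eval (F : fieldType) (n : nat) (T : {mpoly F[3 * n]})
  (p1 p2 : 'rV[F]_n) : {mpoly F[n]} :=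
  let A : 'M[{mpoly F[n]}]_(3, n) :=
    \matrix_(i, j) [:: (p1 0 j)%:MP; (p2 0 j)%:MP; 'X_j]`_i in
  T \mPo [tuple mxvec A 0 k | k < 3 * n].

Definition bias (R : realType) (F : finFieldType) (n : nat)
  (T : tensor3 F n) : R :=
  #|[set p : 'rV[F]_n * 'rV[F]_n | partial_eval T p.1 p.2 == 0]|%:R
    / #|[set: 'rV[F]_n * 'rV[F]_n]|%:R.

Definition analytic_rank (R : realType) (F : finFieldType) (n : nat)
  (T : tensor3 F n) : R :=
  - (ln (bias R T) / ln #|F|%:R).

Definition slice_decomposable (F : fieldType) (n : nat)
  (T : {mpoly F[3 * n]}) (r : nat) : Prop :=
  exists (S : 'I_r -> {set 'I_3}) (T1 T2 : 'I_r -> {mpoly F[3 * n]}),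
    (forall k, [/\ #|S k| = 1%N, multilinear (S k) (T1 k)
                 & multilinear (~: S k) (T2 k)])
    /\ T = \sum_k T1 k * T2 k.

Lemma ml_monomial_multilinear (F : fieldType) (n : nat) (S : {set 'I_3})
  (c : F) (j : index_choice n S) : multilinear S (c *: ml_monomial F j).
Proof.
exists (fun j' => if j' == j then c else 0).
rewrite (bigD1 j) //= eqxx big1 ?addr0 // => j' /negPf ->.
by rewrite scale0r.
Qed.

Lemma ml_monomial_prod (F : fieldType) (n : nat) (S : {set 'I_3})
  (f : 'I_3 -> 'I_n) :
  ml_monomial F ([ffun i => f (val i)] : index_choice n S)
  = \prod_(i in S) xvar F i (f i).
Proof.
rewrite [RHS]big_sub; apply: eq_bigr => i _.
by rewrite ffunE.
Qed.

Lemma slice_decomposable_ex (F : fieldType) (n : nat) (T : tensor3 F n) :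
  exists r, asbool (slice_decomposable T r).
Proof.
case: T => T [c /= ->]; pose J := index_choice n [set: 'I_3].
pose f (j : J) (i : 'I_3) := j (exist _ i (in_setT i)).
pose mon (S : {set 'I_3}) (j : J) :=
  ml_monomial F ([ffun i => f j (val i)] : index_choice n S).
exists #|J|; apply/asboolP.
exists (fun _ => [set ord0]), (fun k => c (enum_val k) *: mon [set ord0] (enum_val k)),
  (fun k => 1 *: mon (~: [set ord0]) (enum_val k)); split=> [k|].
  by split; [rewrite cards1 | apply: ml_monomial_multilinear ..].
rewrite (reindex (fun k : 'I_#|J| => enum_val k)) /=;
  last by apply/onW_bij/enum_val_bij.
apply: eq_bigr => k _; rewrite scale1r -scalerAl; congr (_ *: _).
set j := enum_val k; have -> : ml_monomial F j = mon [set: 'I_3] j.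
  apply: eq_bigr => -[i iS] _; rewrite ffunE /f /=.
  by congr (xvar _ _ (j _)); apply: val_inj.
rewrite /mon !ml_monomial_prod big_set1 (bigD1 ord0) ?inE //=; congr (_ * _).
by apply: eq_bigl => i; rewrite !inE.
Qed.

Definition slice_rank (F : fieldType) (n : nat) (T : tensor3 F n) : nat :=
  ex_minn (slice_decomposable_ex T).

(* Main.v *)
(* Fix bases, so that T(x, y, z) = y M(x) z^T with M(x) a matrix linear in x,
   and let Z be the set of pairs (x, y) with y M(x) = 0.  For fixed y the
   x with (x, y) in Z form a subspace X_y of some codimension s(y).

   Let r(y) be the largest rank of M on the points of X_y over the infinite
   field F(t).  If M(v) has rank r(y), then maximality forces every M(x), x in
   X_y, to vanish on ker M(v) x coker M(v); these kernels are defined over F(t),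
   but saturating them over F[t] and setting t = 0 yields subspaces over F of
   codimension r(y).  Hence SR(T) <= s(y) + 2 r(y).

   Moreover r(y) <= q/(q-1) times the average of rk M over X_y: a line over
   F(t) meets the hyperplanes of X_y at distinct times, and along a line of
   direction v the ranks drop by at most rk M(v) in total, so that the average
   rank can be estimated by induction over hyperplanes.

   Averaging over (x, y) uniform in Z gives
     SR(T) <= E s(y) + 2q/(q-1) E rk M(x),
   and both expectations are at most AR(T) by convexity, since the fibres of Z
   have q^(n - s(y)) and q^(n - rk M(x)) elements. *)
Require Import Defs.
From mathcomp Require Import all_boot all_order all_algebra.
From mathcomp Require Import ring lra.
From mathcomp Require Import -(notations) boolp reals exp.
From mathcomp Require Import mpoly.

Set Implicit Arguments.
Unset Strict Implicit.
Unset Printing Implicit Defensive.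

Import Order.TTheory GRing.Theory Num.Theory.
Local Open Scope ring_scope.

(** * Matrix pencils and combinations of matrices *)

Section Pencils.
Variable L : fieldType.

(** Plays the part of a nonzero minor of size [\rank A], without a choice of rows and columns. *)
Lemma rank_corner (a b : nat) (A : 'M[L]_(a, b)) :
  exists (P : 'M[L]_(\rank A, a)) (Q : 'M[L]_(b, \rank A)),
    P *m A *m Q = 1%:M.
Proof.
have [P PK] := row_fullP (col_base_full A).
have [Q QK] := row_freeP (row_base_free A).
exists P, Q; rewrite -QK; congr (_ *m _).
by rewrite -[X in P *m X]mulmx_base mulmxA PK mul1mx.
Qed.

(** With [P *m A *m Q = 1%:M], the pencil becomes [P *m B *m Q + t%:M], so the drop in rank at [t]
    is at most the dimension of an eigenspace for [- t]. Eigenspaces for distinct eigenvalues are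
    independent in a space of dimension [\rank A]. *)
Lemma pencil_rank_defect (I : finType) (D : pred I) (a b : nat)
  (B A : 'M[L]_(a, b)) (t : I -> L) :
  {in D &, injective t} ->
  (\sum_(i | D i) (\rank A - \rank (B + t i *: A)%R) <= \rank A)%N.
Proof.
move=> t_inj; have [P [Q PQ]] := rank_corner A.
have nt_inj : {in D &, injective (fun i => - t i)}.
  by move=> i j Di Dj /oppr_inj; exact: t_inj.
have dx := mxdirect_sum_eigenspace (P *m B *m Q) nt_inj.
pose V := (\sum_(i | D i) eigenspace (P *m B *m Q) (- t i))%MS.
apply: leq_trans (rank_leq_col V); rewrite /V.
rewrite (mxdirectP dx) /=; apply: leq_sum => i _.
rewrite /eigenspace raddfN opprK mxrank_ker leq_sub2l //.
have -> : P *m B *m Q + (t i)%:M = P *m (B + t i *: A) *m Q.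
  by rewrite mulmxDr mulmxDl -scalemxAr -scalemxAl PQ scalemx1.
by apply: (leq_trans (mxrankM_maxl _ _)); exact: mxrankM_maxr.
Qed.

Hypothesis L_inf : forall p : {poly L}, p != 0 -> exists s, p.[s] != 0.

Lemma common_nonroot (I : finType) (D : pred I) (p : I -> {poly L}) :
  (forall i, D i -> p i != 0) -> exists s, forall i, D i -> (p i).[s] != 0.
Proof.
move=> p_neq0; have [|s] := L_inf (p := \prod_(i | D i) p i).
  by apply/prodf_neq0.
by rewrite horner_prod => /prodf_neq0 ?; exists s.
Qed.

(* [x] is taken on the moment curve [(1, s, s ^+ 2, ..)], on which each
   condition becomes a nonzero polynomial in [s]. *)
Lemma common_nonzero (I : finType) (D : pred I) (m : nat)
  (c : I -> 'cV[L]_m) :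
  (forall i, D i -> c i != 0) ->
  exists x : 'rV[L]_m, forall i, D i -> (x *m c i) 0 0 != 0.
Proof.
move=> c_neq0.
have [|s s_ok] := common_nonroot (D := D) (p := fun i => rVpoly (c i)^T).
  move=> i /c_neq0; apply: contraNneq => /(congr1 (poly_rV (d := m))).
  by rewrite rVpolyK linear0 => /(congr1 trmx); rewrite trmxK trmx0 => ->.
exists (\row_i s ^+ i) => i /s_ok.
rewrite (@horner_coef_wide _ m) ?size_poly // mxE.
suff -> : \sum_(j < m) (rVpoly (c i)^T)`_j * s ^+ j =
  \sum_j (\row_k s ^+ k) 0 j * c i j 0 by [].
apply: eq_bigr => j _.
by rewrite coef_rVpoly_ord !mxE mulrC.
Qed.

Lemma horner_det_pencil (k : nat) (B A : 'M[L]_k) (s : L) :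
  (\det (map_mx polyC B + 'X *: map_mx polyC A)).[s] = \det (B + s *: A).
Proof.
rewrite -horner_evalE -det_map_mx; congr (\det _).
by apply/matrixP=> i j; rewrite !mxE -[LHS]/(horner _ _) !hornerE mulrC.
Qed.

End Pencils.

Section MatrixCombination.

Definition mxcomb (K : nzRingType) (m a b : nat) (A : 'I_m -> 'M[K]_(a, b))
  (x : 'rV[K]_m) : 'M[K]_(a, b) := \sum_i x 0 i *: A i.

Variables (K : nzRingType) (m a b : nat).
Implicit Types (A : 'I_m -> 'M[K]_(a, b)) (x y : 'rV[K]_m).

Lemma mxcombD A x y : mxcomb A (x + y) = mxcomb A x + mxcomb A y.
Proof.
by rewrite -big_split; apply: eq_bigr => i _; rewrite mxE scalerDl.
Qed.

Lemma mxcombZ A c x : mxcomb A (c *: x) = c *: mxcomb A x.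
Proof.
by rewrite /mxcomb scaler_sumr; apply: eq_bigr => i _; rewrite mxE scalerA.
Qed.

Lemma mxcomb0 A : mxcomb A 0 = 0.
Proof. by rewrite -(scale0r 0) mxcombZ scale0r. Qed.

Lemma mxcomb_mul A k (V : 'M[K]_(k, m)) (y : 'rV[K]_k) :
  mxcomb A (y *m V) = mxcomb (fun j => mxcomb A (row j V)) y.
Proof.
rewrite /mxcomb; under [RHS]eq_bigr => j _ do rewrite scaler_sumr.
rewrite exchange_big /=; apply: eq_bigr => i _; rewrite mxE scaler_suml.
by apply: eq_bigr => j _; rewrite scalerA mxE.
Qed.

Lemma map_mxcomb (K' : nzRingType) (f : {rmorphism K -> K'}) A x :
  map_mx f (mxcomb A x) = mxcomb (fun i => map_mx f (A i)) (map_mx f x).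
Proof.
by rewrite /mxcomb map_mx_sum; apply: eq_bigr => i _; rewrite map_mxZ mxE.
Qed.

End MatrixCombination.

(** * Kernels, and sums over kernels and fibres *)

Lemma kermx_row_base (F : fieldType) (n k : nat) (M : 'M[F]_(n, k)) :
  exists2 V : 'M[F]_(n - \rank M, n), row_free V & (V :=: kermx M)%MS.
Proof.
rewrite -mxrank_ker; exists (row_base (kermx M)).
  exact: row_base_free.
exact: eq_row_base.
Qed.

Section KernelSums.
Variables (F : finFieldType) (n k d : nat) (M : 'M[F]_(n, k)) (V : 'M[F]_(d, n)).
Hypotheses (V_free : row_free V) (V_ker : (V :=: kermx M)%MS).

Lemma sum_kermx (g : 'rV[F]_n -> nat) :
  (\sum_(x : 'rV_n | (x *m M == 0)%R) g x = \sum_(y : 'rV_d) g (y *m V)%R)%N.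
Proof.
rewrite (reindex (fun y : 'rV_d => y *m V)) /=.
  apply: eq_bigl => y; apply/eqP/sub_kermxP.
  by rewrite -V_ker submxMl.
exists (fun x => x *m pinvmx V) => [y _ | x].
  exact: mulmxKp.
by rewrite inE => /eqP/sub_kermxP; rewrite -V_ker => /mulmxKpV.
Qed.

End KernelSums.

Lemma card_kermx (F : finFieldType) (n k : nat) (M : 'M[F]_(n, k)) :
  #|[set x : 'rV[F]_n | x *m M == 0]| = (#|F| ^ (n - \rank M))%N.
Proof.
have [V Vf VK] := kermx_row_base M.
rewrite -sum1_card; under eq_bigl => x do rewrite inE.
by rewrite (sum_kermx Vf VK) sum1_card card_mx mul1n.
Qed.

(** Group the terms by the value of [t]: one representative per value forms an injective family, and
    each value occurs at most [k] times. *)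
Lemma sum_fibres (I : finType) (T : eqType) (D : pred I) (t : I -> T)
  (f : T -> nat) (k N : nat) :
  (forall i, D i -> #|[pred j | D j && (t j == t i)]| <= k)%N ->
  (forall E : pred I, subpred E D -> {in E &, injective t} ->
     \sum_(i | E i) f (t i) <= N)%N ->
  (\sum_(i | D i) f (t i) <= k * N)%N.
Proof.
move=> fib_le sum_le.
pose rep i := choose [pred j | D j && (t j == t i)] i.
have repP i : D i -> D (rep i) && (t (rep i) == t i).
  move=> Di; apply: (chooseP (P := [pred j | D j && (t j == t i)])).
  by rewrite /= Di eqxx.
have rep_eq i j : D i -> D j -> t i = t j -> rep i = rep j.
  move=> Di Dj tij; rewrite /rep tij; apply: choose_id; rewrite /= ?Di ?Dj ?tij eqxx //.
pose E := [pred i | D i && (rep i == i)].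
have E_D : subpred E D by move=> i /andP[].
rewrite (partition_big rep E) => [|i Di]; last first.
  have /andP[Dr /eqP tr] := repP i Di.
  by rewrite inE Dr /=; apply/eqP/rep_eq.
apply: leq_trans (leq_mul (leqnn k) (sum_le E E_D _)); last first.
  move=> i j /andP[Di /eqP ri] /andP[Dj /eqP rj] tij.
  by rewrite -ri -rj; apply: rep_eq.
rewrite big_distrr /=; apply: leq_sum => i /andP[Di /eqP ri].
rewrite (eq_bigr (fun=> f (t i))) => [|j /andP[Dj /eqP <-]]; last first.
  by have /andP[_ /eqP ->] := repP j Dj.
rewrite sum_nat_const leq_mul2r; apply/orP; right.
apply: leq_trans (fib_le i Di); apply: subset_leq_card.
apply/subsetP => j; rewrite !inE => /andP[Dj /eqP rj]; rewrite Dj /=.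
by have /andP[_] := repP j Dj; rewrite rj eq_sym.
Qed.

(** * The average rank of a matrix space *)

Section AverageRank.
Variables (F : finFieldType) (L : fieldType) (iota : {rmorphism F -> L}).
Hypothesis L_inf : forall p : {poly L}, p != 0 -> exists s, p.[s] != 0.

Notation "M ^i" := (map_mx iota M) (at level 2, format "M ^i").
Notation "A ^I" := (fun j => map_mx iota (A j)) (at level 2, format "A ^I").

(** If [v *m l^i] is nonzero, this is the parameter at which the line through [x] of direction [v]
    meets the hyperplane of [l]. *)
Definition hyperplane_time (m : nat) (x v : 'rV[L]_m) (l : 'cV[F]_m) : L :=
  - ((x *m l^i) 0 0 / (v *m l^i) 0 0).

(** Replace [v] by [v + s *: w], where [w] avoids the finitely many hyperplanes defined over [F]. A
    suitable [s] avoids the roots of finitely many nonzero polynomials: one of degree 1 for each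
    [l], and a minor equal to 1 at [s = 0] that keeps the rank from dropping. *)
Lemma generic_direction (m a b : nat) (A : 'I_m -> 'M[F]_(a, b)) (v : 'rV[L]_m) :
  exists2 v' : 'rV[L]_m, (\rank (mxcomb A^I v) <= \rank (mxcomb A^I v'))%N
    & forall l : 'cV[F]_m, l != 0 -> (v' *m l^i) 0 0 != 0.
Proof.
have [|w w_neq0] := common_nonzero L_inf (D := [pred l : 'cV[F]_m | l != 0])
  (c := fun l => l^i).
  by move=> l; rewrite map_mx_eq0.
have [P [Q PQ]] := rank_corner (mxcomb A^I v).
pose N u := P *m mxcomb A^I u *m Q.
pose p (o : option 'cV[F]_m) := if o is Some l then
  ((v *m l^i) 0 0)%:P + ((w *m l^i) 0 0)%:P * 'X
  else \det (map_mx polyC (N v) + 'X *: map_mx polyC (N w)).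
have [|s s_ok] := common_nonroot L_inf
  (D := fun o => if o is Some l then l != 0 else true) (p := p).
  move=> [l l_neq0|_] /=.
    apply: contraNneq (w_neq0 _ l_neq0) => /(congr1 (fun p : {poly L} => p`_1)).
    by rewrite coefD coefC coefCM coefX mulr1 coef0 add0r => ->.
  apply: contraTneq (oner_neq0 L) => /(congr1 (horner^~ 0)).
  by rewrite horner_det_pencil scale0r addr0 horner0 /N PQ det1 => ->; rewrite eqxx.
exists (v + s *: w) => [|l l_neq0]; last first.
  have := s_ok (Some l) l_neq0; rewrite /p !hornerE.
  by rewrite mulmxDl -scalemxAl !mxE mulrC.
have := s_ok None isT; rewrite /p horner_det_pencil.
have -> : N v + s *: N w = N (v + s *: w).
  by rewrite /N mxcombD mxcombZ mulmxDr mulmxDl -scalemxAr -scalemxAl.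
rewrite -unitfE -[_ \is a GRing.unit]/(_ \in unitmx) -row_free_unit => /eqP <-.
by apply: (leq_trans (mxrankM_maxl _ _)); exact: mxrankM_maxr.
Qed.

(** Equality of the times of [l] and [l'] is a linear condition on [x], which is trivial only if [l]
    and [l'] are proportional. A generic [x] violates all the nontrivial ones. *)
Lemma generic_basepoint (m : nat) (v : 'rV[L]_m) :
  (forall l : 'cV[F]_m, l != 0 -> (v *m l^i) 0 0 != 0) ->
  exists x : 'rV[L]_m, forall l l' : 'cV[F]_m, l != 0 -> l' != 0 ->
    hyperplane_time x v l = hyperplane_time x v l' -> exists c : F, l = c *: l'.
Proof.
move=> v_neq0.
pose c (l : 'cV[F]_m * 'cV[F]_m) :=
  (v *m l.2^i) 0 0 *: l.1^i - (v *m l.1^i) 0 0 *: l.2^i.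
have [//|x x_ok] := common_nonzero L_inf (D := fun l => c l != 0) (c := c).
exists x => l l' l_neq0 l'_neq0 /oppr_inj tll'.
have /eqP c0 : c (l, l') == 0.
  apply/negP => /negP/x_ok/negP; apply.
  rewrite /c mulmxBr -!scalemxAr; apply/eqP.
  rewrite [LHS]mxE [X in X + _]mxE [X in _ + X]mxE [X in - X]mxE.
  move/eqP: tll'; rewrite eqr_div ?v_neq0 //= => /eqP tll'.
  by apply/eqP; rewrite subr_eq0 mulrC tll' mulrC.
(* So far [l] and [l'] are proportional over [L]; a nonzero entry of [l'] shows that the ratio lies
   in [F]. *)
have [i li_neq0] : exists i, l' i 0 != 0.
  apply/existsP; apply: contraNT l'_neq0 => /existsPn l'0.
  by apply/eqP/matrixP => i j; rewrite ord1 mxE; apply/eqP/negPn/l'0.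
exists (l i 0 / l' i 0); apply/matrixP=> j k; rewrite ord1 mxE {k}.
have eqc k : (v *m l'^i) 0 0 * iota (l k 0) = (v *m l^i) 0 0 * iota (l' k 0).
  by apply/eqP; rewrite -subr_eq0; move/matrixP: c0 => /(_ k 0); rewrite !mxE => ->.
apply: (mulIf li_neq0); rewrite mulrAC divfK //.
apply: (fmorph_inj iota); rewrite !rmorphM.
apply: (mulfI (v_neq0 _ l'_neq0)).
by rewrite mulrA eqc mulrA eqc; ring.
Qed.

Lemma time_on_hyperplane (m : nat) (x v : 'rV[L]_m) (l : 'cV[F]_m) :
  (v *m l^i) 0 0 != 0 -> (x + hyperplane_time x v l *: v) *m l^i = 0.
Proof.
move=> vl; apply/matrixP=> j k; rewrite !ord1 mulmxDl -scalemxAl.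
by rewrite [LHS]mxE [X in _ + X]mxE [RHS]mxE /hyperplane_time mulNr divfK // subrr.
Qed.

Lemma card_scalar_multiples (m : nat) (l : 'cV[F]_m) (E : pred 'cV[F]_m) :
  (forall l', E l' -> l' != 0 /\ exists c : F, l' = c *: l) ->
  (#|E| <= #|F|.-1)%N.
Proof.
move=> El; rewrite -(cardC1 (0 : F)).
apply: leq_trans (leq_imset_card (fun c => c *: l) (predC1 0)).
apply: subset_leq_card; apply/subsetP=> l' /El [l'_neq0 [c def_l']].
apply/imsetP; exists c => //; rewrite inE; apply: contraNneq l'_neq0 => c0.
by rewrite def_l' c0 scale0r.
Qed.

(** Only proportional forms share a time, so each time occurs at most q - 1 times, while
    [pencil_rank_defect] bounds the total drop over distinct times. *)
Lemma hyperplane_defect (m a b : nat) (A : 'I_m -> 'M[F]_(a, b)) (x v : 'rV[L]_m) :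
  (forall l l' : 'cV[F]_m, l != 0 -> l' != 0 ->
    hyperplane_time x v l = hyperplane_time x v l' -> exists c : F, l = c *: l') ->
  (\sum_(l : 'cV[F]_m | l != 0%R) (\rank (mxcomb A^I v) -
     \rank (mxcomb A^I (x + hyperplane_time x v l *: v)%R))
   <= #|F|.-1 * \rank (mxcomb A^I v))%N.
Proof.
move=> t_inj; set r := \rank _.
apply: (sum_fibres (f := fun t => (r - \rank (mxcomb A^I (x + t *: v)%R))%N)).
  move=> l l_neq0; apply: (@card_scalar_multiples _ l) => l' /andP[l'_neq0 /eqP].
  by split=> //; apply: t_inj.
move=> E _ E_inj; under eq_bigr => l _ do rewrite mxcombD mxcombZ.
exact: pencil_rank_defect.
Qed.

Lemma card_hyperplanes_through (m : nat) (x : 'rV[F]_m.+1) :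
  x != 0 -> #|[pred l : 'cV[F]_m.+1 | (l != 0) && (x *m l == 0)]| = (#|F| ^ m).-1.
Proof.
move=> x_neq0; have := card_kermx x^T.
rewrite mxrank_tr rank_rV x_neq0 subn1 /= => <-.
rewrite (cardsD1 0) inE mul0mx eqxx /=.
rewrite -(card_imset ([set y : 'rV[F]_m.+1 | y *m x^T == 0] :\ 0) (@trmx_inj F _ _)).
apply: eq_card => l; apply/idP/imsetP => [/andP[l_neq0 /eqP xl]|[y]].
  exists l^T; rewrite ?trmxK // !inE -trmx_mul xl trmx0 eqxx andbT.
  by apply: contraNneq l_neq0 => /(congr1 trmx); rewrite trmxK trmx0 => ->.
rewrite !inE => /andP[y_neq0 /eqP yx] ->.
rewrite -[x in x *m _]trmxK -trmx_mul yx trmx0 eqxx andbT.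
by apply: contraNneq y_neq0 => /(congr1 trmx); rewrite trmxK trmx0 => ->.
Qed.

Lemma mxcomb_map_mul (m k a b : nat) (A : 'I_m -> 'M[F]_(a, b))
  (V : 'M[F]_(k, m)) (y : 'rV[L]_k) :
  mxcomb A^I (y *m V^i) = mxcomb (fun j => mxcomb A (row j V))^I y.
Proof.
rewrite mxcomb_mul; apply: eq_bigr => j _.
by rewrite map_mxcomb map_row.
Qed.

(* Induction on [m] through the hyperplanes [x *m l = 0]: a line of direction
   [v] over [L] meets nonproportional hyperplanes at distinct times. *)
Theorem average_rank (m a b : nat) (A : 'I_m -> 'M[F]_(a, b)) (v : 'rV[L]_m) :
  (#|F|.-1 * #|F| ^ m * \rank (mxcomb A^I v)
   <= #|F| * \sum_(x : 'rV[F]_m) \rank (mxcomb A x))%N.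
Proof.
have q_gt1 : (1 < #|F|)%N := card_finNzRing_gt1 F.
elim: m A v => [|m IHm] A v.
  by rewrite [mxcomb _ v]big_ord0 mxrank0 muln0.
have [v' v'_le v_neq0] := generic_direction A v.
apply: leq_trans (leq_mul (leqnn _) v'_le) _.
move: v' v_neq0 {v v'_le} => v v_neq0.
set S := (\sum_x _)%N.
(* Dimension one is treated apart, since the factor q^m - 1 cancelled at the end would be 0. There
   all nonzero [x] give the same rank. *)
have [m0|m_gt0] := posnP m.
  subst m.
  rewrite expn1 [(_ * #|F|)%N]mulnC -mulnA leq_mul2l; apply/orP; right.
  rewrite /S (bigD1 0) //= mxcomb0 mxrank0 add0n.
  have rk_le : (\rank (mxcomb A^I v) <= \rank (A ord0))%N.
    by rewrite [mxcomb _ _]big_ord1 -(mxrank_map iota (A ord0)); apply: mxrank_scale.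
  rewrite (eq_bigr (fun=> \rank (A ord0))) => [|x x_neq0]; last first.
    rewrite [mxcomb _ _]big_ord1 mxrank_scale_nz //.
    apply: contraNneq x_neq0 => x0; apply/eqP/matrixP=> i j.
    by rewrite !ord1 x0 mxE.
  by rewrite sum_nat_const cardC1 card_mx mul1n expn1 leq_mul2l rk_le orbT.
have [x t_inj] := generic_basepoint v_neq0.
pose p l := x + hyperplane_time x v l *: v.
set r := \rank (mxcomb A^I v).
(* The point [p l] lies on the hyperplane of [l], to which the induction hypothesis applies. *)
have p_le l : l != 0 -> (#|F|.-1 * #|F| ^ m * \rank (mxcomb A^I (p l))
    <= #|F| * \sum_(x | (x *m l == 0)%R) \rank (mxcomb A x))%N.
  move=> l_neq0; have := kermx_row_base l.
  rewrite -mxrank_tr rank_rV trmx_eq0 l_neq0 subn1 /= => -[V Vf Vk].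
  have [y ->] : exists y : 'rV_m, p l = y *m V^i.
    apply/submxP/(submx_trans (B := (kermx l)^i)); last by rewrite map_submx Vk.
    by rewrite map_kermx; apply/sub_kermxP/time_on_hyperplane/v_neq0.
  rewrite (sum_kermx Vf Vk) mxcomb_map_mul.
  by under eq_bigr => z _ do rewrite mxcomb_mul; apply: IHm.
(* The q^(m+1) - 1 nonzero forms would contribute [r] each; the total defect is at most (q - 1)
   r. *)
have sum_p : ((#|F| ^ m.+1 - #|F|) * r
    <= \sum_(l : 'cV[F]_m.+1 | l != 0%R) \rank (mxcomb A^I (p l)))%N.
  have := hyperplane_defect A t_inj; rewrite -/r => defect_le.
  have nb_l : #|[pred l : 'cV[F]_m.+1 | l != 0]| = (#|F| ^ m.+1).-1.
    by rewrite -[RHS](_ : #|predC1 (0 : 'cV[F]_m.+1)| = _) // cardC1 card_mx muln1.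
  have : (\sum_(l : 'cV[F]_m.+1 | l != 0%R) r <=
      \sum_(l : 'cV[F]_m.+1 | l != 0%R) (r - \rank (mxcomb A^I (p l)))
      + \sum_(l : 'cV[F]_m.+1 | l != 0%R) \rank (mxcomb A^I (p l)))%N.
    by rewrite -big_split /=; apply: leq_sum => l _; rewrite addnC -leq_subLR.
  rewrite sum_nat_const nb_l => sum_ge.
  have N_gt0 : (0 < #|F| ^ m.+1)%N by rewrite expn_gt0 ltnW.
  have predM k : (0 < k)%N -> (k * r = r + k.-1 * r)%N.
    by move=> k_gt0; rewrite -mulSn prednK.
  rewrite mulnBl leq_subLR (predM _ N_gt0) (predM _ (ltnW q_gt1)) -addnA.
  by rewrite leq_add2l (leq_trans sum_ge) // leq_add2r.
have : (\sum_(l | l != 0%R) (#|F|.-1 * #|F| ^ m * \rank (mxcomb A^I (p l)))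
    <= \sum_(l : 'cV[F]_m.+1 | l != 0%R)
         #|F| * \sum_(x | (x *m l == 0)%R) \rank (mxcomb A x))%N.
  exact: leq_sum.
rewrite -!big_distrr /=.
(* A nonzero vector is killed by q^m - 1 nonzero forms, and the zero vector contributes rank 0. *)
have -> : (\sum_(l : 'cV[F]_m.+1 | l != 0%R)
    \sum_(x | (x *m l == 0)%R) \rank (mxcomb A x) = (#|F| ^ m).-1 * S)%N.
  rewrite (exchange_big_dep xpredT) //= /S big_distrr /=; apply: eq_bigr => z _.
  rewrite sum_nat_const; have [->|z_neq0] := eqVneq z 0.
    by rewrite mxcomb0 mxrank0 !muln0.
  by rewrite -(card_hyperplanes_through z_neq0).
move=> le_S; have {sum_p}le_S := leq_trans (leq_mul (leqnn _) sum_p) le_S.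
have N_gt0 : (0 < (#|F| ^ m).-1)%N.
  rewrite -subn1 subn_gt0; apply: (leq_trans q_gt1).
  by rewrite -{1}(expn1 #|F|) leq_exp2l.
rewrite -(leq_pmul2l N_gt0).
have q_pow : (#|F| ^ m.+1 - #|F| = #|F| * (#|F| ^ m).-1)%N.
  by rewrite -subn1 mulnBr muln1 -expnS.
have -> : ((#|F| ^ m).-1 * (#|F|.-1 * #|F| ^ m.+1 * r)
    = #|F|.-1 * #|F| ^ m * ((#|F| ^ m.+1 - #|F|) * r))%N.
  by rewrite q_pow expnS; ring.
by rewrite [X in (_ <= X)%N]mulnCA.
Qed.

End AverageRank.

(** * Matrix spaces of bounded rank *)

Section MaximalRank.
Variable L : fieldType.
Hypothesis L_inf : forall p : {poly L}, p != 0 -> exists s, p.[s] != 0.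

(** As [u] and [w] annihilate [A], the last row is divisible by [s]. The remaining factor is lower
    triangular at [s = 0], with determinant given by [u *m B *m w]. *)
Lemma bordered_minor (a b r : nat) (A B : 'M[L]_(a, b))
  (P : 'M[L]_(r, a)) (Q : 'M[L]_(b, r)) (u : 'rV[L]_a) (w : 'cV[L]_b) (s : L) :
  P *m A *m Q = 1%:M -> u *m A = 0 -> A *m w = 0 ->
  col_mx P u *m (A + s *: B) *m row_mx Q w =
  block_mx 1%:M 0 0 s%:M *m
    (block_mx 1%:M 0 (u *m B *m Q) (u *m B *m w)
     + s *: block_mx (P *m B *m Q) (P *m B *m w) 0 0).
Proof.
move=> PQ uA Aw.
rewrite scale_block_mx add_block_mx mulmx_block mul_col_mx mul_col_row.
rewrite !scaler0 !addr0 !add0r !mul1mx !mul0mx !addr0 !add0r !mul_scalar_mx.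
rewrite !mulmxDr !mulmxDl -!scalemxAr -!scalemxAl PQ uA !mul0mx !add0r.
by rewrite -[P *m A *m w]mulmxA Aw mulmx0 add0r.
Qed.

(** The bordered minor is [s] times a polynomial whose value at 0 is [u *m B *m w]. Were this value
    nonzero, the minor would be nonzero for some [s], and [A + s *: B] would have rank above
    [\rank A]. *)
Lemma maximal_rank_vanishing (a b : nat) (A B : 'M[L]_(a, b))
  (u : 'rV[L]_a) (w : 'cV[L]_b) :
  (forall s, \rank (A + s *: B)%R <= \rank A)%N ->
  u *m A = 0 -> A *m w = 0 -> u *m B *m w = 0.
Proof.
move=> rank_le uA Aw; have [P [Q PQ]] := rank_corner A.
pose N0 := block_mx 1%:M 0 (u *m B *m Q) (u *m B *m w).
pose N1 := block_mx (P *m B *m Q) (P *m B *m w) 0 (0 : 'M_1).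
pose g := \det (map_mx polyC N0 + 'X *: map_mx polyC N1).
have g0 : g.[0] = (u *m B *m w) 0 0.
  by rewrite /g horner_det_pencil scale0r addr0 /N0 det_lblock det1 mul1r det_mx11.
apply/matrixP=> i j; rewrite !ord1 [RHS]mxE -g0; apply/eqP.
apply: contraT => g_neq0.
have [|s] := L_inf (p := 'X * g).
  rewrite mulf_neq0 ?polyX_eq0 //.
  by apply: contraNneq g_neq0 => ->; rewrite horner0.
rewrite hornerM hornerX /g horner_det_pencil.
have -> : s * \det (N0 + s *: N1) = \det (col_mx P u *m (A + s *: B) *m row_mx Q w).
  by rewrite (bordered_minor _ _ PQ) // det_mulmx det_ublock det1 mul1r det_scalar1.
rewrite -unitfE -[_ \is a GRing.unit]/(_ \in unitmx) -row_free_unit => /eqP full.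
have : (\rank (col_mx P u *m (A + s *: B) *m row_mx Q w) <= \rank A)%N.
  apply: leq_trans (rank_le s).
  by apply: (leq_trans (mxrankM_maxl _ _)); exact: mxrankM_maxr.
by rewrite full addn1 ltnn.
Qed.

End MaximalRank.

(** * Specialization of kernels from F(t) to F *)

Section Specialization.
Variable F : fieldType.

Notation at0 := (map_mx (horner_eval (0 : F))).

Lemma det_replace_row (k : nat) (i : 'I_k) (e : 'rV[F]_k) :
  \det (\matrix_(j, l) if j == i then e 0 l else (j == l)%:R) = e 0 i.
Proof.
rewrite (expand_det_col _ i) (bigD1 i) //= big1 ?addr0 => [|j /negPf ji]; last first.
  by rewrite mxE ji mul0r.
rewrite mxE eqxx /cofactor addnn -signr_odd odd_double expr0 mul1r.
rewrite (_ : row' i _ = 1%:M) ?det1 ?mulr1 //.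
by apply/matrixP=> j l; rewrite !mxE eq_sym (negPf (neq_lift _ _)) (inj_eq lift_inj).
Qed.

(* While [K] at 0 is row dependent, a constant combination of its rows is
   divisible by ['X]; dividing it out lowers the degree of [\det (K *m C)]. *)
Lemma saturate (k a : nat) (K : 'M[{poly F}]_(k, a)) (C : 'M[{poly F}]_(a, k)) :
  \det (K *m C) != 0 ->
  exists2 Q : 'M[{poly F}]_(k, a), row_free (at0 Q)
    & forall c (G : 'M[{poly F}]_(a, c)), K *m G = 0 -> Q *m G = 0.
Proof.
have [N] := ubnP (size (\det (K *m C))).
elim: N K => // N IHN K; rewrite ltnS => size_le det_neq0.
have [K_free|] := boolP (row_free (at0 K)); first by exists K.
rewrite -kermx_eq0 => /rowV0Pn [e /sub_kermxP eK e_neq0].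
have [i ei_neq0] : exists i, e 0 i != 0.
  by apply/existsP; apply: contraNT e_neq0 => /existsPn e0;
     apply/eqP/rowP => j; rewrite mxE; apply/eqP/negPn/e0.
pose eK' := map_mx polyC e *m K.
have X_dvd l : 'X %| eK' 0 l.
  rewrite -['X]subr0 -polyC0 dvdp_XsubCl; apply/eqP.
  move/matrixP: eK => /(_ 0 l); rewrite [RHS]mxE => eK0; rewrite -[RHS]eK0.
  rewrite !mxE horner_sum; apply: eq_bigr => j _.
  by rewrite !mxE hornerM hornerC.
(* Row [i] is the one replaced because [e 0 i] is nonzero, which makes [E] invertible; the division
   by ['X] is recorded by [D]. *)
pose K' := \matrix_(j, l) if j == i then eK' 0 l %/ 'X else K j l.
pose D : 'M[{poly F}]_k := diag_mx (\row_j if j == i then 'X else 1).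
pose E : 'M[F]_k := \matrix_(j, l) if j == i then e 0 l else (j == l)%:R.
have DK' : D *m K' = map_mx polyC E *m K.
  apply/matrixP=> j l; rewrite mul_diag_mx !mxE.
  have [->|ji] := eqVneq j i.
    rewrite mulrC divpK; last by have := X_dvd l; rewrite mxE.
    apply: eq_bigr => h _.
    by rewrite !mxE eqxx.
  rewrite mul1r (bigD1 j) //= big1 ?addr0 => [|h hj].
    by rewrite !mxE (negPf ji) eqxx mul1r.
  by rewrite !mxE (negPf ji) eq_sym (negPf hj) mul0r.
have detD : \det D = 'X.
  rewrite det_diag (bigD1 i) //= big1 ?mulr1 ?mxE ?eqxx // => j /negPf ji.
  by rewrite mxE ji.
have det_eq : 'X * \det (K' *m C) = (e 0 i)%:P * \det (K *m C).
  rewrite -detD -det_mulmx mulmxA DK' -mulmxA det_mulmx det_map_mx.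
  by rewrite det_replace_row.
have det'_neq0 : \det (K' *m C) != 0.
  apply: contraNneq det_neq0 => det0; move/eqP: det_eq.
  by rewrite det0 mulr0 eq_sym mulf_eq0 polyC_eq0 (negPf ei_neq0).
have [|//|Q Q_free QG] := IHN K'.
  have := congr1 (fun p : {poly F} => size p) det_eq.
  rewrite mulrC size_mulX // mul_polyC size_scale // => size_eq.
  by rewrite size_eq.
exists Q => // c G KG; apply: QG.
have : D *m (K' *m G) = 0 by rewrite mulmxA DK' -mulmxA KG mulmx0.
rewrite mul_diag_mx => /matrixP D0; apply/matrixP=> j l.
have /eqP := D0 j l; rewrite !mxE mulf_eq0 => /orP[|/eqP//].
by case: ifP => _; rewrite ?polyX_eq0 ?oner_eq0.
Qed.

Lemma fraction_numden (R : idomainType) (x : {fraction R}) :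
  exists2 d : R, d != 0 & exists n : R, tofrac d * x = tofrac n.
Proof.
elim/quotW: x => x; exists \d_x; first exact: denom_ratioP.
exists \n_x; unlock tofrac; rewrite -[LHS]FracField.pi_mul.
apply/eqmodP; rewrite /= FracField.equivfE /FracField.mulf.
by rewrite !numden_Ratio ?mulf_neq0 ?oner_neq0 ?denom_ratioP // mul1r mulr1.
Qed.

Lemma clear_denominators (R : idomainType) (m n : nat) (M : 'M[{fraction R}]_(m, n)) :
  exists2 d : R, d != 0 & exists N : 'M[R]_(m, n),
    map_mx (@tofrac R) N = tofrac d *: M.
Proof.
have /fin_all_exists2 [d d_neq0 dM] (ij : 'I_m * 'I_n) := fraction_numden (M ij.1 ij.2).
have /fin_all_exists [p dMp] := dM.
exists (\prod_ij d ij); first by apply/prodf_neq0.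
exists (\matrix_(i, j) ((\prod_(ij | ij != (i, j)) d ij) * p (i, j))).
apply/matrixP=> i j; rewrite !mxE rmorphM [in RHS](bigD1 (i, j)) //= rmorphM.
by rewrite -dMp mulrCA mulrA.
Qed.

Lemma map_mx_tofrac_inj (R : idomainType) (m n : nat) :
  injective (map_mx (@tofrac R) : 'M_(m, n) -> 'M_(m, n)).
Proof.
move=> A B /matrixP AB; apply/matrixP => i j.
by have /eqP := AB i j; rewrite !mxE tofrac_eq => /eqP.
Qed.

(** A base of the left kernel, cleared of denominators, is saturated; its right inverse supplies the
    nonzero determinant. That the rows of [Q] stay in the kernel is stated through the matrices [G]
    killed by the kernel, the form in which [saturate] preserves it. *)
Lemma kernel_specialization (a b : nat) (A : 'M[{fraction {poly F}}]_(a, b)) :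
  exists2 Q : 'M[{poly F}]_(a - \rank A, a), row_free (at0 Q)
    & forall c (G : 'M[{fraction {poly F}}]_(a, c)),
        (forall u : 'rV_a, u *m A = 0 -> u *m G = 0) ->
        map_mx (@tofrac _) Q *m G = 0.
Proof.
have [K /row_freeP[C KC] K_ker] := kermx_row_base A.
have [d d_neq0 [K' K'E]] := clear_denominators K.
have [e e_neq0 [C' C'E]] := clear_denominators C.
have [|Q Q_free QG] := @saturate _ _ K' C'.
  rewrite -tofrac_eq0 -det_map_mx map_mxM K'E C'E -scalemxAl -scalemxAr KC.
  by rewrite !detZ det1 mulr1 mulf_neq0 ?expf_neq0 ?tofrac_eq0.
exists Q => // c G uG; have [g g_neq0 [G' G'E]] := clear_denominators G.
have KG : K *m G = 0.
  apply/row_matrixP => i; rewrite row_mul uG ?row0 //.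
  by apply/sub_kermxP; rewrite -K_ker row_sub.
have /(congr1 (map_mx (@tofrac _))) : Q *m G' = 0.
  apply: QG; apply: map_mx_tofrac_inj.
  by rewrite map_mxM K'E G'E -scalemxAl -scalemxAr KG !scaler0 map_mx0.
rewrite map_mxM G'E -scalemxAr map_mx0 => /eqP.
by rewrite scaler_eq0 tofrac_eq0 (negPf g_neq0) => /eqP.
Qed.

End Specialization.

(** The powers of t are distinct, so [size p] of them cannot all be roots of [p]. *)
Lemma fraction_poly_infinite (F : fieldType) (p : {poly {fraction {poly F}}}) :
  p != 0 -> exists s, p.[s] != 0.
Proof.
move=> p_neq0; pose rs := [seq tofrac ('X^i : {poly F}) | i <- iota 0 (size p)].
have /allPn [s _ ps] : ~~ all (root p) rs.
  apply/negP => /(max_poly_roots p_neq0); rewrite size_map size_iota ltnn.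
  suff -> : uniq rs by move/(_ isT).
  rewrite map_inj_uniq ?iota_uniq // => i j /eqP; rewrite tofrac_eq => /eqP.
  by move/(congr1 (fun p : {poly F} => size p)); rewrite !size_polyXn => -[].
by exists s.
Qed.

(* Matrices of maximal rank among the [x]-combinations, over the infinite field
   [F(t)], give kernels on which every combination vanishes; the kernels are
   then brought back to [F] by setting [t = 0]. *)
Theorem compression (F : fieldType) (m a b : nat) (A : 'I_m -> 'M[F]_(a, b)) :
  exists (v : 'rV[{fraction {poly F}}]_m),
  let r := \rank (mxcomb (fun j => map_mx (@tofrac _ \o @polyC F) (A j)) v) in
  exists (U : 'M[F]_(a - r, a)) (W : 'M[F]_(b - r, b)),
    [/\ row_free U, row_free W & forall x, U *m mxcomb A x *m W^T = 0].
Proof.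
pose AL j := map_mx (@tofrac {poly F} \o @polyC F) (A j).
have [v v_max] : exists v, forall v', (\rank (mxcomb AL v') <= \rank (mxcomb AL v))%N.
  pose P k := asbool (exists v, \rank (mxcomb AL v) = k).
  have P_ex : exists k, P k by exists (\rank (mxcomb AL 0)); apply/asboolP; exists 0.
  have P_le k : P k -> (k <= a)%N by move=> /asboolP[v <-]; apply: rank_leq_row.
  case: (ex_maxnP P_ex P_le) => k /asboolP[v <-] k_max; exists v => v'.
  by apply: k_max; apply/asboolP; exists v'.
exists v; rewrite -/AL; set M := mxcomb AL v; move=> r; rewrite {}/r.
have [U U_free UG] := kernel_specialization M.
have := kernel_specialization M^T; rewrite mxrank_tr => -[W W_free WG].
pose at0 k l (N : 'M[{poly F}]_(k, l)) := map_mx (horner_eval (0 : F)) N.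
exists (at0 _ _ U), (at0 _ _ W); split=> // x.
pose G := map_mx (@polyC F) (mxcomb A x); pose GL := map_mx (@tofrac _) G.
have vanish (u : 'rV_a) (w : 'cV_b) : u *m M = 0 -> M *m w = 0 -> u *m GL *m w = 0.
  move=> uM Mw; rewrite /GL /G -map_mx_comp (map_mxcomb (@tofrac _ \o @polyC F)).
  apply: (maximal_rank_vanishing (@fraction_poly_infinite F) (A := M)) => // s.
  by rewrite -mxcombZ -mxcombD; apply: v_max.
(* The two kernels are specialized in turn: for fixed [w] in the right kernel, [UG] passes from all
   [u] to the rows of [U]; then [WG] passes from all [w] to the rows of [W]. *)
have WG0 : map_mx (@tofrac _) (W *m (U *m G)^T) = 0.
  rewrite map_mxM -map_trmx map_mxM; apply: WG => w wM.
  rewrite -[w]trmxK -trmx_mul -mulmxA UG ?trmx0 // => u uM.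
  by rewrite mulmxA vanish // -[M]trmxK -trmx_mul wM trmx0.
have {}WG0 : W *m (U *m G)^T = 0.
  by apply: map_mx_tofrac_inj; rewrite WG0 map_mx0.
have -> : mxcomb A x = at0 _ _ G.
  by apply/matrixP=> i j; rewrite !mxE -[RHS]/(horner _ _) hornerC.
rewrite /at0 map_trmx -!map_mxM.
have -> : U *m G *m W^T = 0 by rewrite -[LHS]trmxK trmx_mul trmxK WG0 trmx0.
exact: map_mx0.
Qed.

(** * Slice decompositions of polynomials *)

Section SliceRank.
Variables (F : fieldType) (n : nat).
Implicit Types (S : {set 'I_3}) (p : {mpoly F[3 * n]}).

Lemma multilinear_sum (I : finType) S (p : I -> {mpoly F[3 * n]}) :
  (forall i, multilinear S (p i)) -> multilinear S (\sum_i p i).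
Proof.
move=> /fin_all_exists [c cE]; exists (fun j => \sum_i c i j).
under [RHS]eq_bigr => j _ do rewrite scaler_suml.
by rewrite exchange_big; apply: eq_bigr.
Qed.

Lemma multilinear_mono S (c : F) (f : 'I_3 -> 'I_n) :
  multilinear S (c *: \prod_(i in S) xvar F i (f i)).
Proof. by rewrite -ml_monomial_prod; apply: ml_monomial_multilinear. Qed.

Lemma multilinear1 (s : 'I_3) (c : F) (j : 'I_n) :
  multilinear [set s] (c *: xvar F s j).
Proof. by have := multilinear_mono [set s] c (fun=> j); rewrite big_set1. Qed.

Lemma multilinear2 (s t : 'I_3) (c : F) (j k : 'I_n) : s != t ->
  multilinear [set s; t] (c *: (xvar F s j * xvar F t k)).
Proof.
move=> st; have := multilinear_mono [set s; t] c (fun i => if i == s then j else k).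
by rewrite big_setU1 ?inE //= big_set1 eqxx eq_sym (negPf st).
Qed.

Lemma slice_decomposableD p1 p2 r1 r2 :
  slice_decomposable p1 r1 -> slice_decomposable p2 r2 ->
  slice_decomposable (p1 + p2) (r1 + r2).
Proof.
move=> [S1 [A1 [B1 [ok1 ->]]]] [S2 [A2 [B2 [ok2 ->]]]].
pose glue (T : Type) (f : 'I_r1 -> T) (g : 'I_r2 -> T) (k : 'I_(r1 + r2)) :=
  match split k with inl i => f i | inr j => g j end.
exists (glue _ S1 S2), (glue _ A1 A2), (glue _ B1 B2); split.
  by move=> k; rewrite /glue; case: split => i; [apply: ok1 | apply: ok2].
rewrite big_split_ord /=; congr (_ + _); apply: eq_bigr => i _; rewrite /glue.
  by rewrite (unsplitK (inl i)).
by rewrite (unsplitK (inr i)).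
Qed.

Definition trilinear (c : 'I_n -> 'I_n -> 'I_n -> F) : {mpoly F[3 * n]} :=
  \sum_i \sum_j \sum_k c i j k *:
    (xvar F (inord 0) i * (xvar F (inord 1) j * xvar F (inord 2) k)).

Lemma trilinearD c1 c2 :
  trilinear (fun i j k => c1 i j k + c2 i j k) = trilinear c1 + trilinear c2.
Proof.
rewrite -big_split; apply: eq_bigr => i _; rewrite -big_split.
apply: eq_bigr => j _; rewrite -big_split; apply: eq_bigr => k _.
by rewrite scalerDl.
Qed.

(** Each index [a] contributes one slice, whose linear factor has the coefficients [u i a]. *)
Lemma slice_decomposable_factor (s t1 t2 : 'I_3) (r : nat)
  (u : 'I_n -> 'I_r -> F) (w : 'I_r -> 'I_n -> 'I_n -> F) :
  t1 != t2 -> ~: [set s] = [set t1; t2] ->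
  slice_decomposable (\sum_i \sum_j \sum_k (\sum_a u i a * w a j k) *:
    (xvar F s i * (xvar F t1 j * xvar F t2 k))) r.
Proof.
move=> t12 sC.
exists (fun=> [set s]), (fun a => \sum_i u i a *: xvar F s i),
  (fun a => \sum_j \sum_k w a j k *: (xvar F t1 j * xvar F t2 k)); split=> [a|].
  rewrite cards1 sC; split=> //; apply: multilinear_sum => i.
    exact: multilinear1.
  by apply: multilinear_sum => j; apply: multilinear2.
under [RHS]eq_bigr => a _ do rewrite mulr_suml.
rewrite [RHS]exchange_big; apply: eq_bigr => i _.
under [RHS]eq_bigr => a _ do rewrite mulr_sumr.
rewrite [RHS]exchange_big; apply: eq_bigr => j _.
under [RHS]eq_bigr => a _ do rewrite mulr_sumr.
rewrite [RHS]exchange_big; apply: eq_bigr => k _.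
rewrite scaler_suml; apply: eq_bigr => a _.
by rewrite -scalerAl -scalerAr scalerA.
Qed.

Lemma ord3_setC (s t1 t2 : 'I_3) :
  s != t1 -> s != t2 -> t1 != t2 -> ~: [set s] = [set t1; t2].
Proof.
move=> s1 s2 t12; apply/setP=> x; rewrite !inE.
apply/idP/idP => [xs|/orP[]/eqP->]; rewrite 1?eq_sym //.
by move: s t1 t2 x s1 s2 t12 xs; do 4![case=> [[|[|[|?]]] ?]].
Qed.

Lemma inord3_neq (i j : nat) : (i < 3)%N -> (j < 3)%N -> i != j ->
  (inord i : 'I_3) != inord j.
Proof. by move=> i3 j3; rewrite -val_eqE /= !inordK. Qed.

Lemma slice_decomposable1 r (u : 'I_n -> 'I_r -> F) w :
  slice_decomposable (trilinear (fun i j k => \sum_a u i a * w a j k)) r.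
Proof. by apply: slice_decomposable_factor; [|apply: ord3_setC]; apply: inord3_neq. Qed.

Lemma slice_decomposable2 r (u : 'I_n -> 'I_r -> F) w :
  slice_decomposable (trilinear (fun i j k => \sum_a u j a * w a i k)) r.
Proof.
suff -> : trilinear (fun i j k => \sum_a u j a * w a i k) =
  \sum_j \sum_i \sum_k (\sum_a u j a * w a i k) *:
    (xvar F (inord 1) j * (xvar F (inord 0) i * xvar F (inord 2) k)).
  by apply: slice_decomposable_factor; [|apply: ord3_setC]; apply: inord3_neq.
rewrite exchange_big; do 3![apply: eq_bigr => ? _].
by rewrite mulrCA.
Qed.

Lemma slice_decomposable3 r (u : 'I_n -> 'I_r -> F) w :
  slice_decomposable (trilinear (fun i j k => \sum_a u k a * w a i j)) r.
Proof.
suff -> : trilinear (fun i j k => \sum_a u k a * w a i j) =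
  \sum_k \sum_i \sum_j (\sum_a u k a * w a i j) *:
    (xvar F (inord 2) k * (xvar F (inord 0) i * xvar F (inord 1) j)).
  by apply: slice_decomposable_factor; [|apply: ord3_setC]; apply: inord3_neq.
rewrite [RHS]exchange_big; apply: eq_bigr => i _.
rewrite [RHS]exchange_big; do 2![apply: eq_bigr => ? _].
by congr (_ *: _); rewrite mulrA mulrC.
Qed.

Lemma multilinear_trilinear (p : {mpoly F[3 * n]}) :
  multilinear [set: 'I_3] p ->
  exists C : 'I_n -> 'M[F]_n, p = trilinear (fun i j k => C i j k).
Proof.
case=> c ->; pose J := index_choice n [set: 'I_3].
pose at_ (s : nat) (f : J) := f (exist _ (inord s) (in_setT (inord s))).
(* Exactly one index choice [f] meets the three conditions; summing over [f] avoids constructing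
   it. *)
exists (fun i => \matrix_(j, k)
  \sum_(f : J | [&& at_ 0%N f == i, at_ 1%N f == j & at_ 2%N f == k]) c f).
rewrite /trilinear (partition_big (at_ 0%N) xpredT) //=; apply: eq_bigr => i _.
rewrite (partition_big (at_ 1%N) xpredT) //=; apply: eq_bigr => j _.
rewrite (partition_big (at_ 2%N) xpredT) //=; apply: eq_bigr => k _.
rewrite mxE scaler_suml; apply: eq_big => [f|f /andP[/andP[/eqP<- /eqP<-] /eqP<-]].
  by rewrite andbA.
congr (_ *: _); pose g (s : 'I_3) := f (exist _ s (in_setT s)).
have -> : ml_monomial F f = \prod_(s in [set: 'I_3]) xvar F s (g s).
  rewrite -ml_monomial_prod; apply: eq_bigr => -[s sS] _; rewrite ffunE /g /=.
  by congr (xvar _ _ (f _)); apply: val_inj.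
rewrite (eq_bigl xpredT) => [|s]; last by rewrite inE.
rewrite !big_ord_recl big_ord0 mulr1.
by congr (_ * (_ * _)); rewrite /at_ -/(g _); congr (xvar _ _ (g _));
   apply: val_inj; rewrite /= inordK.
Qed.

Lemma partial_eval_trilinear (C : 'I_n -> 'M[F]_n) (x y : 'rV[F]_n) :
  (partial_eval (trilinear (fun i j k => C i j k)) x y == 0)
  = (y *m mxcomb C x == 0).
Proof.
have eval_xvar (s : 'I_3) (j : 'I_n) :
    xvar F s j \mPo [tuple mxvec (\matrix_(i < 3, l < n)
      [:: (x 0 l)%:MP; (y 0 l)%:MP; 'X_l]`_i : 'M[{mpoly F[n]}]_(3, n)) 0 k | k < 3 * n]
    = [:: (x 0 j)%:MP; (y 0 j)%:MP; 'X_j : {mpoly F[n]}]`_s.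
  by rewrite /xvar comp_mpolyXU -tnth_nth tnth_mktuple mxvecE mxE.
have -> : partial_eval (trilinear (fun i j k => C i j k)) x y
    = \sum_k (y *m mxcomb C x) 0 k *: 'X_k.
  rewrite /partial_eval /trilinear raddf_sum /=.
  under eq_bigr => i _.
    rewrite raddf_sum /=; under eq_bigr => j _.
      rewrite raddf_sum /=; under eq_bigr => k _.
        rewrite comp_mpolyZ !rmorphM /= !eval_xvar !inordK //= !mul_mpolyC !scalerA.
        over.
      over.
    over.
  under eq_bigr => i _ do rewrite exchange_big /=.
  rewrite exchange_big /=; apply: eq_bigr => k _.
  rewrite exchange_big /= mxE scaler_suml; apply: eq_bigr => j _.
  rewrite /mxcomb summxE mulr_sumr scaler_suml; apply: eq_bigr => i _.
  by rewrite mxE mulrCA mulrA mulrC.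
apply/eqP/eqP => [/mpolyP sum0|->]; last first.
  by rewrite big1 // => k _; rewrite mxE scale0r.
apply/rowP => k; move: (sum0 U_(k)%MM); rewrite mcoeff0 raddf_sum /= (bigD1 k) //=.
rewrite big1 => [|l /negPf lk]; first
  by rewrite mcoeffZ mcoeffXU eqxx mulr1 addr0 => ->; rewrite mxE.
by rewrite mcoeffZ mcoeffXU lk mulr0.
Qed.

End SliceRank.

(** * Counting zeros *)

(** [P] is a projection onto the row space of [V]. As [V *m (1%:M - P) = 0], the rank of [1%:M - P]
    is at most [n - d], and [G *m H] is a rank factorization of it. *)
Lemma split_identity (F : fieldType) (d n : nat) (V : 'M[F]_(d, n)) :
  row_free V ->
  exists s (G : 'M[F]_(n, s)) (H : 'M[F]_(s, n)) (P : 'M[F]_n),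
    [/\ (s <= n - d)%N, (P <= V)%MS & 1%:M = P + G *m H].
Proof.
move=> Vf; pose P := pinvmx V *m V; pose N := 1%:M - P.
exists (\rank N), (col_base N), (row_base N), P; split; last 1 first.
- by rewrite mulmx_base addrC subrK.
- have VN : V *m N = 0 by rewrite mulmxBr mulmx1 mulmxA mulmxVp // mul1mx subrr.
  have := mulmx0_rank_max VN; rewrite (eqP Vf).
  rewrite -{2}[\rank N](addKn d); exact: leq_sub2r.
- exact: submxMl.
Qed.

(** * Slices from vanishing on a product of subspaces *)

Section Vanishing.
Variables (F : fieldType) (n : nat) (C : 'I_n -> 'M[F]_n).

Lemma mxcomb_row1 i : mxcomb C (row i 1%:M) = C i.
Proof.
rewrite /mxcomb (bigD1 i) //= big1 ?addr0 => [|j ji].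
  by rewrite !mxE eqxx scale1r.
by rewrite !mxE eq_sym (negPf ji) scale0r.
Qed.

(** Split the identity along [V], then along [U] and [W] in what remains. Each [G *m H] part factors
    through few indices, hence gives slices in its own direction; the part seen by all three
    projections vanishes. *)
Lemma slice_of_vanishing (d e g : nat) (V : 'M[F]_(d, n)) (U : 'M[F]_(e, n))
    (W : 'M[F]_(g, n)) :
  row_free V -> row_free U -> row_free W ->
  (forall x, (x <= V)%MS -> U *m mxcomb C x *m W^T = 0) ->
  exists2 r, (r <= (n - d) + (n - e) + (n - g))%N
    & slice_decomposable (trilinear (fun i j k => C i j k)) r.
Proof.
move=> /split_identity[s1 [G1 [H1 [P1 [s1_le P1V id1]]]]].
move=> /split_identity[s2 [G2 [H2 [P2 [s2_le P2U id2]]]]].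
move=> /split_identity[s3 [G3 [H3 [P3 [s3_le P3W id3]]]]] vanish.
exists (s1 + s2 + s3)%N; first by rewrite !leq_add.
have -> : (fun i j k => C i j k) = (fun i j k =>
   \sum_a G1 i a * mxcomb C (row a H1) j k
   + \sum_a G2 j a * (H2 *m mxcomb C (row i P1)) a k
   + \sum_a G3 k a * (H3 *m (P2 *m mxcomb C (row i P1))^T) a j).
  apply/funext => i; apply/funext => j; apply/funext => k.
  rewrite -(mxcomb_row1 i) id1 linearD /= row_mul mxcombD mxcomb_mul.
  rewrite mxE addrC {1}/mxcomb summxE -addrA; congr (_ + _).
    by apply: eq_bigr => a _; rewrite !mxE.
  set M := mxcomb C (row i P1).
  rewrite -[in LHS](mul1mx M) id2 mulmxDl mxE addrC; congr (_ + _).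
    by rewrite -mulmxA mxE.
  transitivity ((P2 *m M)^T k j); first by rewrite [RHS]mxE.
  rewrite -[in LHS](mul1mx (P2 *m M)^T) id3 mulmxDl.
  rewrite [LHS]mxE -mulmxA [X in _ + X]mxE.
  rewrite (_ : P3 *m (P2 *m M)^T = 0) ?mxE ?add0r //.
  have [X2 ->] := submxP P2U; have [X3 ->] := submxP P3W.
  transitivity ((X2 *m (U *m M *m W^T) *m X3^T)^T).
    by rewrite !trmx_mul !trmxK !mulmxA.
  by rewrite vanish ?mulmx0 ?mul0mx ?trmx0 // (submx_trans (row_sub _ _)).
rewrite !trilinearD; apply: slice_decomposableD; first apply: slice_decomposableD.
- exact: (slice_decomposable1 (fun i a => G1 i a)
    (fun a j k => mxcomb C (row a H1) j k)).
- exact: (slice_decomposable2 (fun i a => G2 i a)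
    (fun a i k => (H2 *m mxcomb C (row i P1)) a k)).
- exact: (slice_decomposable3 (fun i a => G3 i a)
    (fun a i j => (H3 *m (P2 *m mxcomb C (row i P1))^T) a j)).
Qed.

End Vanishing.

(** The distribution on [I] with weights [q ^ (n - h i)] over [Z] has entropy at most [ln #|I|], and
    the logarithm of a weight is affine in [h i]. *)
Lemma entropy_bound (R : realType) (I : finType) (q n : nat) (h : I -> nat) (Z : R) :
  Z = \sum_i (q ^ (n - h i))%:R -> (1 < q)%N -> (0 < #|I|)%N -> (forall i, h i <= n)%N ->
  (\sum_i (q ^ (n - h i))%:R * (h i)%:R) * ln q%:R
  <= Z * (n%:R * ln q%:R + ln #|I|%:R - ln Z).
Proof.
move=> ZE q_gt1 I_gt0 h_le.
have q_gt0 : 0 < q%:R :> R by rewrite ltr0n ltnW.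
have w_gt0 i : 0 < (q ^ (n - h i))%:R :> R by rewrite ltr0n expn_gt0 ltnW.
have N_gt0 : 0 < #|I|%:R :> R by rewrite ltr0n.
have Z_gt0 : 0 < Z.
  have [i0 _] := card_gt0P I_gt0.
  by rewrite ZE (bigD1 i0) //= ltr_wpDr // sumr_ge0.
(* This is ln u <= u - 1 at u = Z / (#|I| w), multiplied by the weight w; the right-hand sides sum
   to 0. *)
have term i : (q ^ (n - h i))%:R
      * (ln Z - ln #|I|%:R - n%:R * ln q%:R + (h i)%:R * ln q%:R)
    <= Z / #|I|%:R - (q ^ (n - h i))%:R :> R.
  set w : R := (q ^ (n - h i))%:R.
  have ln_w : ln w = (n%:R - (h i)%:R) * ln q%:R.
    by rewrite /w natrX lnXn // -natrB // mulr_natl.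
  have w_pos : 0 < w := w_gt0 i.
  have u_gt0 : 0 < Z / #|I|%:R / w by rewrite !divr_gt0.
  have := @le_ln1Dx R (Z / #|I|%:R / w - 1); rewrite ltrBrDl subrr => /(_ u_gt0).
  rewrite addrC subrK ln_div ?ln_div ?posrE ?divr_gt0 // ln_w => ln_le.
  have -> : Z / #|I|%:R - w = w * (Z / #|I|%:R / w - 1).
    by rewrite mulrBr mulr1 [w * _]mulrC divfK // gt_eqF.
  rewrite ler_pM2l //; apply: le_trans ln_le; rewrite le_eqVlt; apply/orP; left.
  by apply/eqP; ring.
have := ler_sum (index_enum I) (P := xpredT) (fun i _ => term i).
rewrite [X in _ <= X]sumrB sumr_const -ZE.
have -> : (Z / #|I|%:R) *+ #|I| = Z by rewrite -mulr_natr divfK // gt_eqF.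
rewrite subrr; under eq_bigr => i _ do rewrite mulrDr mulrA.
rewrite big_split /= -!mulr_suml -ZE; lra.
Qed.

(** * The zero set and its two families of fibres *)

Section Counting.
Variables (F : finFieldType) (n : nat) (C : 'I_n -> 'M[F]_n).
Let q := #|F|.

(** The matrix of the tensor with the second argument fixed: its left kernel is X_y and its rank is
    s(y). *)
Definition second_slice (y : 'rV[F]_n) : 'M[F]_n := \matrix_i (y *m C i).

Lemma mul_second_slice x y : x *m second_slice y = y *m mxcomb C x.
Proof.
apply/rowP => k; rewrite mxE mulmx_sumr summxE; apply: eq_bigr => i _.
by rewrite -scalemxAr !mxE.
Qed.

(** [compression] on X_y gives subspaces of codimension [r], so SR <= s + 2 r by
    [slice_of_vanishing]; [average_rank] on X_y bounds [r]. Multiplying by (q - 1) q^(n - s) keeps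
    the inequality in the natural numbers. *)
Lemma slice_fibre (SR : nat) (y : 'rV[F]_n) :
  (forall r, slice_decomposable (trilinear (fun i j k => C i j k)) r -> (SR <= r)%N) ->
  (q.-1 * (q ^ (n - \rank (second_slice y)) * SR)
   <= q.-1 * (q ^ (n - \rank (second_slice y)) * \rank (second_slice y))
     + 2 * (q * \sum_(x : 'rV[F]_n | (y *m mxcomb C x == 0)%R) \rank (mxcomb C x)))%N.
Proof.
move=> SR_le; set s := \rank _.
have [V V_free V_ker] := kermx_row_base (second_slice y).
pose A j := mxcomb C (row j V).
have [v] := compression A; set r := \rank _; move=> [U [W [U_free W_free vanish]]].
have r_le : (r <= n)%N by apply: rank_leq_row.
have [t t_le /SR_le SR_t] : exists2 t,
    (t <= (n - (n - s)) + (n - (n - r)) + (n - (n - r)))%N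
    & slice_decomposable (trilinear (fun i j k => C i j k)) t.
  apply: slice_of_vanishing V_free U_free W_free _ => x /submxP[x' ->].
  by rewrite mxcomb_mul vanish.
have {t t_le SR_t}SR_s : (SR <= s + 2 * r)%N.
  rewrite (leq_trans SR_t) // (leq_trans t_le) // !subKn ?rank_leq_row //.
  by rewrite mul2n -addnn addnA.
have := average_rank (@tofrac {poly F} \o @polyC F) (@fraction_poly_infinite F) A v.
rewrite -/r -/q => avg.
apply: (@leq_trans (q.-1 * (q ^ (n - s) * (s + 2 * r)))%N).
  by rewrite !leq_mul2l SR_s !orbT.
have -> : (q.-1 * (q ^ (n - s) * (s + 2 * r))
    = q.-1 * (q ^ (n - s) * s) + 2 * (q.-1 * q ^ (n - s) * r))%N by ring.
rewrite leq_add2l leq_mul2l /=; apply: leq_trans avg _.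
under [X in (_ <= _ * X)%N]eq_bigl => x do rewrite -mul_second_slice.
rewrite (sum_kermx V_free V_ker) leq_mul2l; apply/orP; right.
by apply: leq_sum => x _; rewrite mxcomb_mul.
Qed.

Definition zero_pairs : {set 'rV[F]_n * 'rV[F]_n} :=
  [set p | p.2 *m mxcomb C p.1 == 0].

Lemma sum_zero_pairs1 (f : 'rV[F]_n -> nat) :
  (\sum_(p in zero_pairs) f p.1 = \sum_x q ^ (n - \rank (mxcomb C x)) * f x)%N.
Proof.
under eq_bigl => p do rewrite inE.
rewrite -(pair_big_dep xpredT (fun x y => y *m mxcomb C x == 0) (fun x y => f x)) /=.
by apply: eq_bigr => x _; rewrite sum_nat_cond_const -card_kermx.
Qed.

Lemma sum_zero_pairs2 (f : 'rV[F]_n -> nat) :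
  (\sum_(p in zero_pairs) f p.2 = \sum_y q ^ (n - \rank (second_slice y)) * f y)%N.
Proof.
under eq_bigl => p do rewrite inE.
rewrite -(pair_big_dep xpredT (fun x y => y *m mxcomb C x == 0) (fun x y => f y)) /=.
rewrite (exchange_big_dep xpredT) //=; apply: eq_bigr => y _.
under eq_bigl => x do rewrite -mul_second_slice.
by rewrite sum_nat_cond_const -card_kermx.
Qed.

(** Sum of [slice_fibre] over [y]: as q^(n - s(y)) counts the [x] paired with [y], this is the
    average over Z without its denominators. *)
Lemma slice_rank_count (SR : nat) :
  (forall r, slice_decomposable (trilinear (fun i j k => C i j k)) r -> (SR <= r)%N) ->
  (q.-1 * #|zero_pairs| * SR <=
     q.-1 * \sum_(p in zero_pairs) \rank (second_slice p.2)
     + 2 * (q * \sum_(p in zero_pairs) \rank (mxcomb C p.1)))%N.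
Proof.
move=> SR_le.
have : (\sum_y q.-1 * (q ^ (n - \rank (second_slice y)) * SR) <= \sum_y
    (q.-1 * (q ^ (n - \rank (second_slice y)) * \rank (second_slice y))
     + 2 * (q * \sum_(x : 'rV[F]_n | (y *m mxcomb C x == 0)%R) \rank (mxcomb C x))))%N.
  by apply: leq_sum => y _; apply: slice_fibre.
rewrite big_split /= -!big_distrr /= -(sum_zero_pairs2 (fun y => \rank (second_slice y))).
rewrite -(sum_zero_pairs2 (fun=> SR)) sum_nat_const mulnA.
suff -> : (\sum_(y : 'rV[F]_n) \sum_(x | (y *m mxcomb C x == 0)%R) \rank (mxcomb C x)
    = \sum_(p in zero_pairs) \rank (mxcomb C p.1))%N by [].
under [RHS]eq_bigl => p do rewrite inE.
rewrite (exchange_big_dep xpredT) //=.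
by rewrite (pair_big_dep xpredT (fun x y => y *m mxcomb C x == 0)
  (fun x _ => \rank (mxcomb C x))).
Qed.

Definition zero_pairs_rank (R : realType) : R :=
  - (ln (#|zero_pairs|%:R / #|[set: 'rV[F]_n * 'rV[F]_n]|%:R) / ln q%:R).

Lemma zero_pairs_gt0 : (0 < #|zero_pairs|)%N.
Proof. by apply/card_gt0P; exists (0, 0); rewrite inE mul0mx. Qed.

(** Serves both projections of Z, [h] being the codimension of the fibres. In [entropy_bound] over
    the q^n points, the bracket equals ln q times the analytic rank. *)
Lemma zero_pairs_entropy (R : realType) (h : 'rV[F]_n -> nat) :
  (forall x, h x <= n)%N -> #|zero_pairs| = (\sum_x q ^ (n - h x))%N ->
  (\sum_x q ^ (n - h x) * h x)%N%:R <= #|zero_pairs|%:R * zero_pairs_rank R.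
Proof.
move=> h_le Z_def; have q_gt1 : (1 < q)%N := card_finNzRing_gt1 F.
have lnq_gt0 : 0 < ln q%:R :> R by rewrite ln_gt0 // ltr1n.
have q_gt0 : 0 < q%:R :> R by rewrite ltr0n ltnW.
have card_rV : #|{: 'rV[F]_n}| = (q ^ n)%N by rewrite card_mx mul1n.
have ZE : #|zero_pairs|%:R = \sum_x (q ^ (n - h x))%:R :> R by rewrite Z_def natr_sum.
have := entropy_bound ZE q_gt1; rewrite card_rV => /(_ _ h_le).
rewrite expn_gt0 ltnW // => /(_ isT).
have -> : (\sum_x q ^ (n - h x) * h x)%N%:R
    = \sum_x (q ^ (n - h x))%:R * (h x)%:R :> R.
  by rewrite natr_sum; apply: eq_bigr => x _; rewrite natrM.
rewrite -[X in _ -> is_true X](ler_pM2r lnq_gt0) => /le_trans; apply.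
 rewrite -mulrA ler_pM2l ?ltr0n ?zero_pairs_gt0 //.
rewrite /zero_pairs_rank mulNr divfK ?gt_eqF // cardsT card_prod card_rV.
rewrite ln_div ?posrE ?ltr0n ?zero_pairs_gt0 ?muln_gt0 ?expn_gt0 ?(ltnW q_gt1) //.
by rewrite natrM lnM ?posrE ?natrX ?exprn_gt0 // lnXn // mulr_natl opprB.
Qed.

End Counting.

Theorem corollary1p5 (R : realType) (F : finFieldType) (n : nat)
  (T : tensor3 F n) :
  (slice_rank T)%:R <= (3 + 2 / (#|F|%:R - 1)) * analytic_rank R T.
Proof.
have [C TC] := multilinear_trilinear (tensor_multilinear T).
have AR_eq : analytic_rank R T = zero_pairs_rank C R.
  rewrite /analytic_rank /bias /zero_pairs_rank; congr (- (ln (_%:R / _) / _)).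
  by apply: eq_card => p; rewrite !inE TC partial_eval_trilinear.
have SR_le r :
    slice_decomposable (trilinear (fun i j k => C i j k)) r -> (slice_rank T <= r)%N.
  rewrite -TC /slice_rank; case: ex_minnP => m _ m_min Tr.
  by apply: m_min; apply/asboolP.
have := slice_rank_count SR_le; rewrite AR_eq.
have q_gt1 : (1 < #|F|)%N := card_finNzRing_gt1 F.
have Z1 : #|zero_pairs C| = (\sum_x #|F| ^ (n - \rank (mxcomb C x)))%N.
  rewrite -[LHS]muln1 -sum_nat_const (sum_zero_pairs1 C (fun=> 1)).
  by apply: eq_bigr => x _; rewrite muln1.
have Z2 : #|zero_pairs C| = (\sum_y #|F| ^ (n - \rank (second_slice C y)))%N.
  rewrite -[LHS]muln1 -sum_nat_const (sum_zero_pairs2 C (fun=> 1)).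
  by apply: eq_bigr => x _; rewrite muln1.
have := zero_pairs_entropy R (fun x => rank_leq_row _) Z1.
have := zero_pairs_entropy R (fun y => rank_leq_row _) Z2.
rewrite -(sum_zero_pairs1 C (fun x => \rank (mxcomb C x))).
rewrite -(sum_zero_pairs2 C (fun y => \rank (second_slice C y))).
move: (zero_pairs_rank C R) (slice_rank T) (zero_pairs_gt0 C) => AR SR Z_gt0.
move: (\sum_(p in _) _)%N (\sum_(p in _) _)%N => S2 S1 S2_le S1_le.
rewrite -(ler_nat R) natrD !natrM -subn1 natrB 1?ltnW // => count.
have q1_gt0 : 0 < #|F|%:R - 1 :> R by rewrite subr_gt0 ltr1n.
have Z_pos : 0 < #|zero_pairs C|%:R :> R by rewrite ltr0n.
rewrite -(ler_pM2l (mulr_gt0 q1_gt0 Z_pos)); apply: le_trans count _.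
(* Both rank sums are at most |Z| AR, and 1 + 2q/(q - 1) = 3 + 2/(q - 1). *)
have -> : (#|F|%:R - 1) * #|zero_pairs C|%:R * ((3 + 2 / (#|F|%:R - 1)) * AR)
   = (#|F|%:R - 1) * (#|zero_pairs C|%:R * AR)
     + 2 * (#|F|%:R * (#|zero_pairs C|%:R * AR)).
  by field; rewrite gt_eqF.
apply: lerD; first by rewrite ler_pM2l.
by rewrite !ler_pM2l // ltr0n ltnW.
Qed.
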